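(* Let $\Gamma$ be a finite simplicial graph and $X=X_\Gamma$. For $r>0$ there are Lipschitz retractions $$\mathcal{P}_r: X_r\to X\setminus B_r$$ which are $O(r)$-Lipschitz; that is, there is a constant $c=c(\Gamma)$ such that $\mathcal{P}_r$ is $(cr+c)$-Lipschitz for each $r>0$. Here $X_r=X\setminus\bigcup_{v\in B_r}B_{1/4}(v)$, the union being over vertices $v$ of $X$ lying in $B_r$.
   Context: $\Gamma$ is a finite graph with no loops or multiple edges, with vertices $a_1,\dots,a_n$; $A_\Gamma=\langle a_1,\dots,a_n\mid [a_i,a_j]=1 \text{ whenever } a_i,a_j \text{ are joined by an edge of }\Gamma\rangle$ is its right-angled Artin group. The flag complex $L$ of $\Gamma$ has the same vertex set, with a set of vertices spanning a simplex iff they are pairwise joined by edges. In the torus $(S^1)^n$ (each $S^1$ with one $0$-cell and one $1$-cell, the $i$-th factor corresponding to $a_i$), take the subcomplex consisting of those cells whose set of $S^1$-factors corresponds to a simplex of $L$ (together with the vertex); $X_\Gamma$ is its universal cover, a cube complex on which $A_\Gamma$ acts. Its vertices are identified with elements of $A_\Gamma$, with basepoint the identity $e$. The $\ell^1$ metric on $X$ is the length metric restricting to the $\ell^1$ metric on each cube. $B_t(x)$ denotes the open $\ell^1$ ball of radius $t$ about $x$, and $B_t=B_t(e)$. $X_r$ is endowed with its length metric induced from the $\ell^1$ metric on $X$; distances in the target are measured in the $\ell^1$ metric of $X$.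
   Formalization: For some r (e.g. r = 1.1) X∖B_r is not contained in X_r, so ''retraction X_r → X∖B_r'' is taken to mean a map of X_r into X∖B_r fixing every point of X_r ∩ (X∖B_r); this is the usual notion whenever X∖B_r ⊂ X_r. *)

(* Defs.v *)
(* MathComp / MathComp-Analysis. *)
From HB Require Import structures.
From mathcomp Require Import all_boot all_order all_algebra.
From mathcomp Require Import generic_quotient.
From mathcomp Require Import all_classical all_reals all_analysis.

Set Implicit Arguments.
Unset Strict Implicit.
Unset Printing Implicit Defensive.

Import Order.TTheory GRing.Theory Num.Theory.
Import numFieldNormedType.Exports.

Local Open Scope classical_set_scope.
Local Open Scope ring_scope.

Section RAAG.
Variables (n : nat) (adj : rel 'I_n).

(* (i, true) stands for the generator a_i and (i, false) for its inverse. *)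
Definition letter : Type := ('I_n * bool)%type.

Definition flip (l : letter) : letter := (l.1, ~~ l.2).

Inductive raag_eq : seq letter -> seq letter -> Prop :=
| raag_refl u : raag_eq u u
| raag_sym u v : raag_eq u v -> raag_eq v u
| raag_trans u v w : raag_eq u v -> raag_eq v w -> raag_eq u w
| raag_cat u u' v v' :
    raag_eq u u' -> raag_eq v v' -> raag_eq (u ++ v) (u' ++ v')
| raag_cancel l : raag_eq [:: l; flip l] [::]
| raag_comm i j : adj i j ->
    raag_eq [:: (i, true); (j, true); (i, false); (j, false)] [::].

Definition raag_eqb (u v : seq letter) : bool := `[< raag_eq u v >].

Lemma raag_eqb_refl : reflexive raag_eqb.
Proof. by move=> u; apply/asboolP; exact: raag_refl. Qed.

Lemma raag_eqb_sym : symmetric raag_eqb.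
Proof. by move=> u v; apply/asboolP/asboolP; exact: raag_sym. Qed.

Lemma raag_eqb_trans : transitive raag_eqb.
Proof.
by move=> v u w /asboolP uv /asboolP vw; apply/asboolP; exact: raag_trans vw.
Qed.

Canonical raag_equiv :=
  EquivRel raag_eqb raag_eqb_refl raag_eqb_sym raag_eqb_trans.

(* The right-angled Artin group A_Gamma. *)
Definition raag : Type := {eq_quot raag_equiv}%qT.
HB.instance Definition _ := Choice.on raag.
HB.instance Definition _ := EqQuotient.on raag.

Definition class_of (u : seq letter) : raag := (\pi_raag u)%qT.

Lemma class_ofP u v : class_of u = class_of v <-> raag_eq u v.
Proof.
split=> [/eqquotP|uv]; first by move/asboolP.
by apply/eqquotP/asboolP.
Qed.

Lemma class_of_repr (g : raag) : class_of (repr g) = g.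
Proof. exact: reprK. Qed.

Lemma raag_eq_repr u : raag_eq (repr (class_of u)) u.
Proof. by apply/class_ofP; rewrite class_of_repr. Qed.

Definition raag_mul (g h : raag) : raag := class_of (repr g ++ repr h).
Definition raag_one : raag := class_of [::].
Definition raag_inv (g : raag) : raag := class_of (map flip (rev (repr g))).

Lemma class_of_cat u v : raag_mul (class_of u) (class_of v) = class_of (u ++ v).
Proof. by apply/class_ofP/raag_cat; exact: raag_eq_repr. Qed.

Fact raag_mulA : associative raag_mul.
Proof.
move=> g h k; rewrite -(class_of_repr g) -(class_of_repr h) -(class_of_repr k).
by rewrite !class_of_cat catA.
Qed.

Fact raag_mul1 : left_id raag_one raag_mul.
Proof. by move=> g; rewrite -(class_of_repr g) class_of_cat. Qed.

Fact raag_1mul : right_id raag_one raag_mul.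
Proof. by move=> g; rewrite -(class_of_repr g) class_of_cat cats0. Qed.

Lemma flipK : involutive flip.
Proof. by case=> i b; rewrite /flip /= negbK. Qed.

Lemma raag_eq_catV u : raag_eq (u ++ map flip (rev u)) [::].
Proof.
elim: u => [|l u IHu]; first exact: raag_refl.
rewrite rev_cons map_rcons -cats1 -cat1s -catA (catA u).
apply: raag_trans (raag_cancel l); rewrite -[X in raag_eq _ X]cat1s.
apply: raag_cat (raag_refl _) _.
by rewrite -[X in raag_eq _ X]cat0s; apply: raag_cat => //; exact: raag_refl.
Qed.

Lemma raag_eq_Vcat u : raag_eq (map flip (rev u) ++ u) [::].
Proof.
have := raag_eq_catV (map flip (rev u)).
by rewrite -map_rev revK -map_comp (eq_map flipK) map_id.
Qed.

Fact raag_mulV : left_inverse raag_one raag_inv raag_mul.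
Proof.
move=> g; rewrite -{2}(class_of_repr g) class_of_cat.
by apply/class_ofP/raag_eq_Vcat.
Qed.

Fact raag_Vmul : right_inverse raag_one raag_inv raag_mul.
Proof.
move=> g; rewrite -{1}(class_of_repr g) class_of_cat.
by apply/class_ofP/raag_eq_catV.
Qed.

HB.instance Definition _ :=
  isGroup.Build raag raag_mulA raag_mul1 raag_1mul raag_mulV raag_Vmul.

Definition gen (i : 'I_n) : raag := class_of [:: (i, true)].

End RAAG.

(* Simplices of the flag complex L; the empty simplex, corresponding to the   *)
(* 0-cell of the torus, is included.                                          *)
Definition simplex (n : nat) (adj : rel 'I_n) (s : {set 'I_n}) : bool :=
  [forall i in s, forall j in s, (i != j) ==> adj i j].

(* The torus (S^1)^n is taken to be [0, 1)^n, the coordinate 0 being the      *)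
(* 0-cell of S^1; the open cell through y has as factors the i with y i != 0. *)
Definition in_salvetti (R : realType) (n : nat) (adj : rel 'I_n)
    (y : {ffun 'I_n -> R}) : bool :=
  [forall i, 0 <= y i < 1] && simplex adj [set i | y i != 0].

Section UniversalCover.
Variables (R : realType) (n : nat) (adj : rel 'I_n).
Local Notation A := (raag adj).

(* The universal cover X of the Salvetti complex S.  As S has one vertex and  *)
(* fundamental group A_Gamma, a point of X above y in S is a homotopy class   *)
(* of paths ending at y; it decomposes uniquely as a loop g in A_Gamma        *)
(* followed by the segment from the vertex to y inside the cell of y.  Thus   *)
(* X is A_Gamma * S as a set, with covering map the second projection and     *)
(* A_Gamma acting by left multiplication on the first factor; the gluing of   *)
(* the lifted cells is given by [cube_point].                                 *)
Definition univ_cover : Type :=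
  {x : A * {ffun 'I_n -> R} | in_salvetti adj x.2}.

Fact in_salvetti0 : in_salvetti adj ([ffun=> 0] : {ffun 'I_n -> R}).
Proof.
apply/andP; split; first by apply/forallP => i; rewrite ffunE lexx ltr01.
by apply/forall_inP => i; rewrite inE ffunE eqxx.
Qed.

Definition vertex (g : A) : univ_cover :=
  @exist _ (fun x => in_salvetti adj x.2) (g, [ffun=> 0]) in_salvetti0.

Definition basepoint : univ_cover := vertex 1%g.

(* [cube_coord s y]: y lies in the cube [0, 1]^s, the coordinates outside s   *)
(* being set to 0.                                                            *)
Definition cube_coord (s : {set 'I_n}) (y : {ffun 'I_n -> R}) : Prop :=
  (forall i, 0 <= y i <= 1) /\ (forall i, i \notin s -> y i = 0).

(* [cube_point g y x]: x is the point with coordinates y in the cubes g[0,1]^s *)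
(* for which [cube_coord s y].  The path from the vertex g to x runs once     *)
(* around each circle i with y i = 1, so it ends over the sheet               *)
(* g * \prod_(i | y i = 1) a_i; the order of these factors is irrelevant as   *)
(* they commute when s is a simplex.                                          *)
Definition cube_point (g : A) (y : {ffun 'I_n -> R}) (x : univ_cover) : Prop :=
  sval x = ((g * \prod_(i < n | (y i == 1)%R) gen adj i)%g,
            [ffun i => if y i == 1 then 0 else y i]).

(* [same_cube_dist x x' l]: some cube of X contains x and x', and l is their  *)
(* l^1 distance in it.                                                        *)
Definition same_cube_dist (x x' : univ_cover) (l : R) : Prop :=
  exists (g : A) (s : {set 'I_n}) (y y' : {ffun 'I_n -> R}),
    [/\ simplex adj s, cube_coord s y /\ cube_coord s y',
        cube_point g y x, cube_point g y' x' & l = \sum_i `|y i - y' i|].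

Inductive chain : univ_cover -> univ_cover -> R -> Prop :=
| chain_nil x : chain x x 0
| chain_cons x y z l l' :
    same_cube_dist x y l -> chain y z l' -> chain x z (l + l').

(* The l^1 length metric of the cube complex X: infimum of the lengths of the *)
(* piecewise straight paths.                                                  *)
Definition dist1 (x y : univ_cover) : \bar R :=
  ereal_inf [set l%:E | l in [set l | chain x y l]].

Definition oball (x : univ_cover) (t : R) : set univ_cover :=
  [set y | (dist1 x y < t%:E)%E].

(* B_r *)
Definition Bbase (r : R) : set univ_cover := oball basepoint r.

(* X_r *)
Definition punctured (r : R) : set univ_cover :=
  ~` \bigcup_(v in range vertex `&` Bbase r) oball v (1 / 4).

End UniversalCover.

Arguments univ_cover R {n} adj.
Arguments vertex R {n} adj g.
Arguments basepoint R {n} adj.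
Arguments dist1 {R n adj} x y.
Arguments oball {R n adj} x t.
Arguments Bbase {R n} adj r.
Arguments punctured {R n} adj r.

Section LengthMetric.
Variables (R : realType) (T : Type) (d : T -> T -> \bar R).

Definition path_in (D : set T) (x y : T) (gam : R -> T) : Prop :=
  [/\ gam 0 = x, gam 1 = y, set_fun `[0, 1] D gam &
      forall t eps : R, t \in `[0, 1] -> 0 < eps ->
        \forall u \near within `[0, 1] (nbhs t), (d (gam t) (gam u) < eps%:E)%E].

Definition path_length (gam : R -> T) : \bar R :=
  ereal_sup [set (\sum_(i < size s)
                    d (gam (nth 0 (0 :: s) i)%R) (gam (nth 0 s i)%R))%E
            | s in [set s : seq R | itv_partition 0 1 s]].

(* The length metric on the subspace D of T, equal to +oo between points not  *)
(* joined by a rectifiable path in D.                                         *)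
Definition length_dist (D : set T) (x y : T) : \bar R :=
  ereal_inf [set path_length gam | gam in [set gam | path_in D x y gam]].

End LengthMetric.

(* [f] is a retraction of D onto E.  It is not required that E `<=` D, so the *)
(* points to be fixed are those of D `&` E.                                   *)
Definition retraction (T : Type) (D E : set T) (f : T -> T) : Prop :=
  set_fun D E f /\ forall x, (D `&` E) x -> f x = x.

Definition lipschitz_between (R : realType) (T U : Type) (D : set T)
    (dT : T -> T -> \bar R) (dU : U -> U -> \bar R) (K : R) (f : T -> U) : Prop :=
  forall x y, D x -> D y -> (dU (f x) (f y) <= K%:E * dT x y)%E.

(* Main.v *)
(* Let h be the l^1 distance from the basepoint. A cube of X has a unique      *)
(* lowest vertex, and h increases at unit speed along each of its edges; an   *)
(* edge going up prolongs to a ray along which h keeps increasing, and the    *)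
(* rays prolonging the edges of a cube span an orthant of a flat. The point   *)
(* with coordinates y_i (counted upwards) in a cube is pushed inside this     *)
(* orthant to y_i + t * phi(y_i) where phi(a) = min(a, 1 - a) and             *)
(* t = max(0, r - h) / sum_i phi(y_i), so that it lands on {h = r}. Since phi *)
(* vanishes at 0 and 1, these maps agree on common faces. The denominator is  *)
(* the distance to the closest vertex, so that t <= 1 + 4 r on X_r.           *)
(* Truncating t at M = 1 + 4 r yields a map defined and (2 M + 2)-Lipschitz   *)
(* on all of X, for which it is enough to bound the stretch in each cube.     *)

Require Import Defs.
From mathcomp Require Import all_boot all_order all_algebra.
From mathcomp Require Import all_classical all_reals all_analysis.
From mathcomp Require Import ring lra.

Set Implicit Arguments.
Unset Strict Implicit.
Unset Printing Implicit Defensive.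

Import Order.TTheory GRing.Theory Num.Theory.
Local Open Scope classical_set_scope.
Local Open Scope ring_scope.

(** * Reduced words in right-angled Artin groups *)

(** The pushing described above works because of how word length behaves on a flat [g * R^s], [s] a
    simplex: each exponent contributes independently, and a line that has started away from the
    basepoint never turns back. To see this, a word is recorded by its projections to the
    non-commuting pairs, kept as stacks; [raag_eq_nf] makes them invariants of the group element,
    [st_mon] separates the exponents, because commuting generators use disjoint stacks, and
    [st_line_up] and [st_line_down] follow the rays.

    Hence [height_flat]: on an upward orthant [height] is affine with slopes 1 and -1. In particular
    it is 1-Lipschitz on cubes, and [dist1_base] identifies it with the distance to the basepoint. A
    push therefore raises it by speed times [vdist], which is the whole gap when no truncation
    occurs ([height_push_map]); [punctured_gap] ensures this on X_r.

    For the Lipschitz bound, [push_map_flat] computes the push in any cube containing the point,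
    [push_coord_lipschitz] bounds the stretch there, and [chain_flat] turns the l^1 distance of the
    images in a flat into the length of a chain. Each link of a chain is thus stretched by at most
    [2 * M + 2], and so are the infima. *)

Definition gpow (G : groupType) (x : G) (k : int) : G :=
  match k with Posz m => (x ^+ m)%g | Negz m => (x^-1 ^+ m.+1)%g end.

Lemma gpowS (G : groupType) (x : G) k : gpow x (k + 1) = (gpow x k * x)%g.
Proof.
case: k => [m|[|m]].
- by rewrite (_ : Posz m + 1 = Posz m.+1) /= ?expgSr // -addn1 PoszD.
- by rewrite /= expg1 mulVg.
have -> : Negz m.+1 + 1 = Negz m by rewrite !NegzE -addn1 PoszD opprD addrNK.
by rewrite /= [in RHS]expgSr mulgVK.
Qed.

Lemma gpowB1 (G : groupType) (x : G) k : gpow x (k - 1) = (gpow x k * x^-1)%g.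
Proof. by rewrite -[in RHS](subrK 1 k) gpowS mulgK. Qed.

Lemma gpowD (G : groupType) (x : G) k m :
  gpow x (k + m) = (gpow x k * gpow x m)%g.
Proof.
elim/int_rect: m => [|m IHm|m IHm]; first by rewrite addr0 /= mulg1.
  by rewrite -addn1 PoszD addrA !gpowS IHm mulgA.
by rewrite -addn1 PoszD opprD addrA !gpowB1 IHm mulgA.
Qed.

Lemma commute_gpow (G : groupType) (x y : G) k m :
  commute x y -> commute (gpow x k) (gpow y m).
Proof.
move=> xy; have pow z : commute x z -> commute (gpow x k) z.
  move=> /commute_sym xz; apply: commute_sym.
  by case: k => j; apply: commuteX => //; exact: commuteV.
by apply: pow; case: m => j; apply: commuteX => //; exact: commuteV.
Qed.

Section NormalForms.
Variables (n : nat) (adj : rel 'I_n).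
Hypotheses (adj_sym : symmetric adj) (adj_irr : irreflexive adj).
Local Notation A := (raag adj).
Local Notation letter := (letter n).

(** Diagonal pairs are included, [adj] being irreflexive: the stack at [(i, i)] lists the
    occurrences of [a_i] and serves to count them. *)
Definition touch (i : 'I_n) (e : 'I_n * 'I_n) : bool :=
  ~~ adj e.1 e.2 && ((e.1 == i) || (e.2 == i)).

Lemma touch_diag i j : touch i (j, j) = (j == i).
Proof. by rewrite /touch /= adj_irr orbb. Qed.

Lemma touch_adj i j e : adj i j -> touch i e -> ~~ touch j e.
Proof.
case: e => p q ij /andP[/= npq] /orP[] /eqP ei; rewrite /touch /= npq /=;
  apply/norP; split; apply/eqP => ej; subst.
- by rewrite adj_irr in ij.
- by rewrite ij in npq.
- by rewrite adj_sym ij in npq.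
- by rewrite adj_irr in ij.
Qed.

(* The projections of a reduced word to the pairs of generators that do not   *)
(* commute, each listed from its last letter; they determine the word up to   *)
(* commutations.                                                              *)
Definition state : Type := {ffun 'I_n * 'I_n -> seq letter}.

Implicit Types (s t : state) (l m : letter) (w : seq letter).

(** For the state of a reduced word, this means that an occurrence of [flip l] can be commuted to
    the end ([reduced_cancels]). *)
Definition cancels s l : bool :=
  [forall e, touch l.1 e ==> (ohead (s e) == Some (flip l))].

Definition push s l : state :=
  [ffun e => if touch l.1 e then l :: s e else s e].

Definition pop s i : state :=
  [ffun e => if touch i e then behead (s e) else s e].

Definition act s l : state := if cancels s l then pop s l.1 else push s l.

Definition nf w : state := foldl act [ffun=> [::]] w.

Lemma nf_cat u v : nf (u ++ v) = foldl act (nf u) v.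
Proof. by rewrite /nf foldl_cat. Qed.

Lemma nf_rcons w l : nf (rcons w l) = act (nf w) l.
Proof. by rewrite -cats1 nf_cat. Qed.

Lemma cancels_local s t l :
  (forall e, touch l.1 e -> s e = t e) -> cancels s l = cancels t l.
Proof.
move=> st; apply: eq_forallb => e; case le: (touch l.1 e) => //=.
by rewrite st.
Qed.

Lemma act_local s t l : (forall e, touch l.1 e -> s e = t e) ->
  forall e, touch l.1 e -> act s l e = act t l e.
Proof.
move=> st e le; rewrite /act (cancels_local st).
by case: ifP => _; rewrite !ffunE le st.
Qed.

Lemma act_untouched s l e : ~~ touch l.1 e -> act s l e = s e.
Proof. by move=> /negbTE le; rewrite /act; case: ifP; rewrite !ffunE le. Qed.

Lemma cancels_push s l : cancels (push s l) (flip l).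
Proof. by apply/forall_inP => e /= le; rewrite ffunE le /= flipK. Qed.

Lemma act_push s l : act (push s l) (flip l) = s.
Proof.
rewrite /act cancels_push; apply/ffunP => e; rewrite !ffunE /=.
by case le: (touch l.1 e); rewrite ?le.
Qed.

Lemma act_pushV s l : act (push s (flip l)) l = s.
Proof. by rewrite -[RHS](act_push s (flip l)) flipK. Qed.

Lemma push_comm s l m : adj l.1 m.1 -> push (push s l) m = push (push s m) l.
Proof.
move=> lm; apply/ffunP => e; rewrite !ffunE.
by have := @touch_adj _ _ e lm; case: ifP => // _; case: ifP => // _ /(_ isT).
Qed.

(** No stack is touched by both letters, and the effect of a letter on its stacks depends on these
    stacks alone. *)
Lemma act_comm s l m : adj l.1 m.1 -> act (act s l) m = act (act s m) l.
Proof.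
move=> lm; have ml : adj m.1 l.1 by rewrite adj_sym.
apply/ffunP => e; have [le|le] := boolP (touch l.1 e).
- rewrite act_untouched ?(touch_adj lm)//; apply: act_local le => e' le'.
  by rewrite act_untouched ?(touch_adj lm).
- rewrite [RHS]act_untouched//; have [me|me] := boolP (touch m.1 e).
    by apply: act_local me => e' me'; rewrite act_untouched ?(touch_adj ml).
  by rewrite !act_untouched.
Qed.

(** * Reduced words and invariance of the stacks *)

Definition lett l : A := class_of adj [:: l].

Lemma class_of_rcons w l :
  class_of adj (rcons w l) = (class_of adj w * lett l)%g.
Proof. by rewrite -cats1 -class_of_cat. Qed.

Lemma lett_flip l : lett (flip l) = (lett l)^-1%g.
Proof.
apply/esym/mulg1_eq; rewrite -[(_ * _)%g]/(raag_mul _ _) class_of_cat.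
by apply/class_ofP; exact: raag_cancel.
Qed.

Lemma class_ofM u v :
  (class_of adj u * class_of adj v)%g = class_of adj (u ++ v).
Proof. exact: class_of_cat. Qed.

Lemma gen_commute i j : adj i j -> commute (gen adj i) (gen adj j).
Proof.
move=> ij; have /class_ofP := raag_comm ij.
rewrite -(class_ofM [:: (i, true); (j, true)] [:: (i, false); (j, false)]).
rewrite -(class_ofM [:: (i, true)] [:: (j, true)]).
rewrite -(class_ofM [:: (i, false)] [:: (j, false)]).
rewrite -[class_of _ [:: (i, false)]]/(lett (flip (i, true))).
rewrite -[class_of _ [:: (j, false)]]/(lett (flip (j, true))) !lett_flip.
rewrite -invgM => /divg1_eq; exact.
Qed.

Lemma lett_commute l m : adj l.1 m.1 -> commute (lett l) (lett m).
Proof.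
case: l m => i b [j c] /= /gen_commute ij.
have lettE k d : lett (k, d) = if d then gen adj k else (gen adj k)^-1%g.
  by case: d => //; exact: (lett_flip (k, true)).
rewrite !lettE; case: b; case: c => //; rewrite /commute.
- exact: commuteV.
- exact/commute_sym/commuteV/commute_sym.
- exact/commuteV/commute_sym/commuteV/commute_sym.
Qed.

(** Words whose stacks are built by pushes only. *)
Inductive reduced : seq letter -> Prop :=
| reduced_nil : reduced [::]
| reduced_rcons w l : reduced w -> ~~ cancels (nf w) l -> reduced (rcons w l).

Lemma nf_push w l : ~~ cancels (nf w) l -> nf (rcons w l) = push (nf w) l.
Proof. by move=> /negbTE wl; rewrite nf_rcons /act wl. Qed.

(** The last letter of [w] is either [flip l] itself or commutes with [l]; in the second case the
    cancelling letter is found earlier and carried past it. *)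
Lemma reduced_cancels w l : reduced w -> cancels (nf w) l ->
  exists w', [/\ reduced w', ~~ cancels (nf w') (flip l),
    class_of adj w = (class_of adj w' * lett (flip l))%g &
    nf w = push (nf w') (flip l)].
Proof.
move=> rw; elim: rw l => {w} [|w m rw IHw wm] l.
  by move/forallP => /(_ (l.1, l.1)); rewrite touch_diag eqxx ffunE.
rewrite nf_push// => wml; have hd e : touch l.1 e -> touch m.1 e -> m = flip l.
  by move/forall_inP: wml => + le me => /(_ e le); rewrite ffunE me => /eqP[].
have [ml|ml] := eqVneq m.1 l.1.
  have := hd (l.1, l.1); rewrite ml touch_diag eqxx => /(_ isT isT) mE.
  by exists w; rewrite -mE class_of_rcons.
(* Otherwise [l] and [m] share the stack at [(l.1, m.1)], whose top [m] would have to be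
   [flip l]. *)
have adj_lm : adj l.1 m.1.
  apply/negPn/negP => nlm; have := hd (l.1, m.1).
  rewrite /touch/= nlm !eqxx orbT => /(_ isT isT) mE.
  by move: ml; rewrite mE eqxx.
have wl : cancels (nf w) l.
  rewrite -(@cancels_local (push (nf w) m))// => e le.
  by rewrite ffunE (negbTE (touch_adj adj_lm le)).
have [w' [rw' w'l clw nfw]] := IHw _ wl.
have w'm : ~~ cancels (nf w') m.
  rewrite -(@cancels_local (nf w))// => e me; rewrite nfw ffunE /=.
  by rewrite (negbTE (touch_adj _ me)) // adj_sym.
exists (rcons w' m); split.
- exact: reduced_rcons.
- rewrite nf_push// (@cancels_local _ (nf w'))// => e le.
  by rewrite ffunE (negbTE (touch_adj adj_lm le)).
- rewrite !class_of_rcons clw -!mulgA; congr (_ * _)%g; exact: lett_commute.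
- by rewrite nf_push// nfw push_comm.
Qed.

Lemma reduceP w :
  exists w', [/\ reduced w', class_of adj w' = class_of adj w & nf w' = nf w].
Proof.
elim/last_ind: w => [|w l [w' [rw' clw nfw]]].
  by exists [::]; split => //; exact: reduced_nil.
rewrite class_of_rcons nf_rcons -clw -nfw.
have [w'l|w'l] := boolP (cancels (nf w') l); last first.
  exists (rcons w' l); rewrite class_of_rcons nf_rcons; split => //.
  exact: reduced_rcons.
have [w0 [rw0 w0l clw' nfw']] := reduced_cancels rw' w'l.
exists w0; split=> //; first by rewrite clw' lett_flip mulgVK.
by rewrite nfw' act_pushV.
Qed.

(** This fails for arbitrary states. A reduced word that cancels [l] is a reduced word followed by
    [flip l], so after the pop [flip l] is pushed back. *)
Lemma act_flip w l : act (act (nf w) l) (flip l) = nf w.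
Proof.
have [w' [rw' _ <-]] := reduceP w.
have [w'l|w'l] := boolP (cancels (nf w') l); last first.
  by rewrite {2}/act (negbTE w'l) act_push.
have [w0 [rw0 w0l _ ->]] := reduced_cancels rw' w'l.
by rewrite act_pushV /act (negbTE w0l).
Qed.

Lemma raag_eq_nf u v : raag_eq adj u v -> nf u = nf v.
Proof.
(* The prefix [w] keeps the induction on states of words, the only ones to which [act_flip]
   applies. *)
move=> uv; suff: forall w, nf (w ++ u) = nf (w ++ v) by move=> /(_ [::]).
elim: uv => {u v} // [u v w _ IHu _ IHv x|u u' v v' _ IHu _ IHv w|l w|i j ij w].
- by rewrite IHu IHv.
- by rewrite !catA IHv nf_cat IHu -nf_cat.
- by rewrite nf_cat cats0 /= act_flip.
- rewrite nf_cat cats0 /= (@act_comm _ (j, true) (i, false)); last first.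
    by rewrite adj_sym.
  by rewrite (act_flip _ (i, true)) (act_flip _ (j, true)).
Qed.

Definition st (g : A) : state := nf (repr g).

Lemma st_class w : st (class_of adj w) = nf w.
Proof. exact/raag_eq_nf/raag_eq_repr. Qed.

Lemma st_lett g l : st (g * lett l)%g = act (st g) l.
Proof. by rewrite -{1}(class_of_repr g) class_ofM cats1 st_class nf_rcons. Qed.

Lemma st_genV g i : st (g * (gen adj i)^-1)%g = act (st g) (i, false).
Proof. by rewrite -[RHS]st_lett -[(i, false)]/(flip (i, true)) lett_flip. Qed.

Lemma st_gen g i : st (g * gen adj i)%g = act (st g) (i, true).
Proof. exact: st_lett. Qed.

Definition len (g : A) : nat := \sum_i size (st g (i, i)).

(* The edge from g to g * gen i leads towards the basepoint. *)
Definition descends (g : A) (i : 'I_n) : bool := cancels (st g) (i, true).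

Lemma len_reduced w : reduced w -> len (class_of adj w) = size w.
Proof.
rewrite /len st_class; elim=> {w} [|w l _ IHw wl].
  by rewrite big1// => i _; rewrite ffunE.
rewrite size_rcons -IHw nf_push// -addn1 [LHS](bigD1 l.1) //=.
rewrite [in RHS](bigD1 l.1) //= ffunE touch_diag eqxx /= addn1 addSn.
congr (_ + _).+1; apply: eq_bigr => i /negbTE il.
by rewrite ffunE touch_diag il.
Qed.

Lemma simplexP (s : {set 'I_n}) :
  reflect {in s &, forall i j, i != j -> adj i j} (simplex adj s).
Proof.
apply: (iffP forall_inP) => [ss i j si sj ij|ss i si].
  by have /forall_inP/(_ j sj)/implyP := ss i si; apply.
by apply/forall_inP => j sj; apply/implyP; exact: ss.
Qed.

(** * Products of powers of commuting generators *)

Local Notation "i ^^ k" := (gpow (gen adj i) k) (at level 29).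

Lemma st_gpow_untouched g i k e : ~~ touch i e -> st (g * i ^^ k)%g e = st g e.
Proof.
move=> ie; case: k => m /=.
  elim: m => [|m IHm]; first by rewrite mulg1.
  by rewrite expgSr mulgA st_gen act_untouched.
elim: m.+1 => [|j IHj]; first by rewrite mulg1.
by rewrite expgSr mulgA st_genV act_untouched.
Qed.

Lemma st_gpow_local g h i k : (forall e, touch i e -> st g e = st h e) ->
  forall e, touch i e -> st (g * i ^^ k)%g e = st (h * i ^^ k)%g e.
Proof.
move=> gh; case: k => m /=.
  elim: m => [|m IHm] e ie; first by rewrite !mulg1 gh.
  by rewrite expgSr !mulgA !st_gen; exact: act_local.
elim: m.+1 => [|j IHj] e ie; first by rewrite !mulg1 gh.
by rewrite expgSr !mulgA !st_genV; exact: act_local.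
Qed.

Lemma st_prod_untouched r (k : 'I_n -> int) g e :
  {in r, forall i, k i != 0 -> ~~ touch i e} ->
  st (g * \prod_(i <- r) i ^^ (k i))%g e = st g e.
Proof.
elim: r g => [|i r IHr] g re; first by rewrite big_nil mulg1.
rewrite big_cons mulgA IHr => [|j jr]; last by apply: re; rewrite inE jr orbT.
have [ki|ki] := eqVneq (k i) 0; first by rewrite ki /= mulg1.
by rewrite st_gpow_untouched ?re// mem_head.
Qed.

Lemma st_prod r (k : 'I_n -> int) g i : uniq r -> i \in r ->
  {in r, forall j, k j != 0 -> j != i -> adj j i} ->
  forall e, touch i e ->
    st (g * \prod_(j <- r) j ^^ (k j))%g e = st (g * i ^^ (k i))%g e.
Proof.
elim: r g => // j r IHr g /= /andP[jr ur]; rewrite in_cons => ijr rk e ie.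
rewrite big_cons mulgA; have [ij|ij] := eqVneq i j.
  rewrite -ij st_prod_untouched // => m mr km; apply: touch_adj ie.
  rewrite adj_sym rk ?in_cons ?mr ?orbT//.
  by apply: contraNneq jr => mi; rewrite -ij -mi.
rewrite IHr//; last 2 first.
- by move: ijr; rewrite (negbTE ij).
- by move=> m mr; apply: rk; rewrite in_cons mr orbT.
apply: st_gpow_local ie => {}e ie; have [kj|kj] := eqVneq (k j) 0.
  by rewrite kj /= mulg1.
apply: st_gpow_untouched; apply: touch_adj ie; rewrite adj_sym rk ?mem_head//.
by rewrite eq_sym.
Qed.

Definition mon (k : 'I_n -> int) : A := (\prod_i i ^^ (k i))%g.

Section Simplex.
Variables (s : {set 'I_n}) (ss : simplex adj s).

(** The other generators of [s] commute with [a_i], hence leave the stacks touched by [i] alone. *)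
Lemma st_mon k g i e : (forall j, j \notin s -> k j = 0) ->
  i \in s -> touch i e -> st (g * mon k)%g e = st (g * i ^^ (k i))%g e.
Proof.
move=> sk si ie; apply: st_prod => //; first exact: index_enum_uniq.
  exact: mem_index_enum.
move=> j _ kj ji; apply: (simplexP _ ss) => //.
by apply: contraNT kj => /sk ->.
Qed.

Lemma st_mon_diag k g i : (forall j, j \notin s -> k j = 0) ->
  st (g * mon k)%g (i, i) = st (g * i ^^ (k i))%g (i, i).
Proof.
move=> sk; have [si|si] := boolP (i \in s).
  by apply: st_mon => //; rewrite touch_diag.
rewrite sk//= mulg1 st_prod_untouched// => j _ kj.
by rewrite touch_diag; apply: contraNneq kj => <-; rewrite sk.
Qed.

Lemma descends_mon k g i : (forall j, j \notin s -> k j = 0) ->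
  i \in s -> descends (g * mon k)%g i = descends (g * i ^^ (k i))%g i.
Proof. by move=> sk si; apply: cancels_local => e; exact: st_mon. Qed.

Lemma mon_add k h : (forall j, j \notin s -> k j = 0) ->
  (forall j, j \notin s -> h j = 0) ->
  mon (fun i => k i + h i) = (mon k * mon h)%g.
Proof.
move=> sk sh; suff comm i j : commute (i ^^ (k i)) (j ^^ (h j)).
  by rewrite /mon -prodgM_commute//; apply: eq_bigr => i _; exact: gpowD.
have [ki|ki] := eqVneq (k i) 0; first by rewrite ki; exact/commute_sym/commute1.
have [hj|hj] := eqVneq (h j) 0; first by rewrite hj; exact/commute1.
have [<-|ij] := eqVneq i j; first exact: commute_gpow.
apply/commute_gpow/gen_commute/(simplexP _ ss) => //.
  by apply: contraNT ki => /sk ->.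
by apply: contraNT hj => /sh ->.
Qed.

End Simplex.

(** Once [(i, true)] has been pushed it sits on top of the stack at [(i, i)], so the next copy
    cannot cancel. *)
Lemma size_st_up g i (k : nat) : ~~ descends g i ->
  ~~ descends (g * i ^^ (Posz k))%g i /\
  size (st (g * i ^^ (Posz k))%g (i, i)) = (size (st g (i, i)) + k)%N.
Proof.
move=> gi; elim: k => [|k [IHm sz]] /=; first by rewrite mulg1 addn0.
rewrite /descends expgSr mulgA st_gen /act -/(descends _ i) (negbTE IHm).
rewrite ffunE touch_diag eqxx /= sz addnS; split=> //.
apply/negP => /forallP/(_ (i, i)).
by rewrite touch_diag eqxx ffunE touch_diag eqxx => /eqP[].
Qed.

Lemma size_st_down g i (k : nat) : descends g i ->
  descends (g * (gen adj i)^-1 ^+ k)%g i /\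
  size (st (g * (gen adj i)^-1 ^+ k)%g (i, i)) = (size (st g (i, i)) + k)%N.
Proof.
move=> gi; elim: k => [|k [IHm sz]] /=; first by rewrite mulg1 addn0.
set h := (_ * _)%g in IHm sz.
have hi : ~~ cancels (st h) (i, false).
  apply/negP => /forallP/(_ (i, i)); move/forallP/(_ (i, i)): IHm.
  by rewrite touch_diag eqxx /= => /eqP -> /eqP[].
rewrite expgSr mulgA -/h /descends st_genV /act (negbTE hi).
by rewrite (cancels_push _ (i, false)) ffunE touch_diag eqxx /= sz addnS.
Qed.

Lemma size_st_gen g i : descends g i ->
  size (st g (i, i)) = (size (st (g * gen adj i)%g (i, i))).+1.
Proof.
move=> gi; rewrite st_gen /act -/(descends _ i) gi ffunE touch_diag eqxx /=.
move/forallP/(_ (i, i)): gi; rewrite touch_diag eqxx /=.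
by case: (st g _).
Qed.

Lemma st_line_up g i (k : int) : ~~ descends g i -> 0 <= k ->
  ~~ descends (g * i ^^ k)%g i /\
  Posz (size (st (g * i ^^ k)%g (i, i))) = Posz (size (st g (i, i))) + k.
Proof. by case: k => // k gi _; have [? ->] := size_st_up k gi. Qed.

Lemma st_line_down g i (k : int) : descends g i -> k <= 0 ->
  descends (g * i ^^ k)%g i /\
  Posz (size (st (g * i ^^ k)%g (i, i))) = Posz (size (st g (i, i))) - k.
Proof.
move=> gi; case: k => [[|k] //|k] _; last first.
  by have [? /= ->] := size_st_down k.+1 gi; rewrite NegzE opprK.
by rewrite /= mulg1 subr0.
Qed.

End NormalForms.

(** * Flats, and the distance to the basepoint *)

Section Flats.
Variables (R : realType) (n : nat) (adj : rel 'I_n).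
Hypotheses (adj_sym : symmetric adj) (adj_irr : irreflexive adj).
Local Notation A := (raag adj).
Local Notation X := (univ_cover R adj).
Local Notation coords := {ffun 'I_n -> R}.
Local Notation flr := Num.floor.
Implicit Types (g : A) (y z Y Z : coords) (x : X) (s : {set 'I_n}).

Definition on s Y := forall i, i \notin s -> Y i = 0.

(* Coordinates on the flat g * R^s for a simplex s: the integer parts move    *)
(* the vertex, the fractional parts are the coordinates in the cube.          *)
Definition flat g Y : A * coords :=
  ((g * mon adj (fun i => flr (Y i)))%g, [ffun i => Y i - (flr (Y i))%:~R]).

(** The default value is never taken when [Y] is supported on a simplex ([flat_pointK]). *)
Definition flat_point g Y : X :=
  insubd (basepoint R adj : {x : A * coords | in_salvetti adj x.2}) (flat g Y).

Lemma simplexS s (t : {set 'I_n}) :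
  t \subset s -> simplex adj s -> simplex adj t.
Proof.
move=> /fintype.subsetP ts /simplexP ss; apply/simplexP => i j ti tj.
by apply: ss; exact: ts.
Qed.

Lemma flat_pointK s g Y : simplex adj s -> on s Y ->
  sval (flat_point g Y) = flat g Y.
Proof.
move=> ss sY; apply: insubdK; rewrite unfold_in /=; apply/andP; split.
  apply/forallP => i; rewrite ffunE; have := floor_itv (Y i).
  by rewrite intrD /=; lra.
apply: simplexS ss; apply/fintype.subsetP => i; rewrite inE ffunE.
by apply: contraNT => /sY ->; rewrite floor0 subr0.
Qed.

Lemma floor01 (a : R) : 0 <= a <= 1 -> flr a = Posz (a == 1).
Proof.
move=> /andP[a0 a1]; have [->|a1'] := eqVneq a 1; first exact: floor1.
by apply: floor_def; rewrite a0 /= lt_neqAle a1'.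
Qed.

Lemma cube_pointE g y x : (forall i, 0 <= y i <= 1) ->
  cube_point g y x <-> sval x = flat g y.
Proof.
move=> y01; rewrite /cube_point; suff -> : flat g y =
  ((g * \prod_(i < n | (y i == 1)%R) gen adj i)%g,
            [ffun i => if y i == 1 then 0 else y i]) by [].
congr (_ * _, _)%g.
  rewrite big_mkcond; apply: eq_bigr => i _; rewrite floor01//.
  by case: ifP => _ /=; rewrite ?expg1.
apply/ffunP => i; rewrite !ffunE floor01//.
by case: eqP => [->|_]; rewrite ?subrr ?subr0.
Qed.

Lemma flat_shift s g (k : 'I_n -> int) Y : simplex adj s -> on s Y ->
  (forall i, i \notin s -> k i = 0) ->
  flat (g * mon adj k)%g Y = flat g [ffun i => (k i)%:~R + Y i].
Proof.
move=> ss sY sk; rewrite /flat -mulgA -(mon_add ss)//; last first.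
  by move=> i /sY ->; rewrite floor0.
have flrD i : flr ((k i)%:~R + Y i) = k i + flr (Y i).
  by rewrite floorDzr// intrKfloor.
congr (_ * _, _)%g; first by apply: eq_bigr => i _; rewrite ffunE flrD.
by apply/ffunP => i; rewrite !ffunE flrD intrD; lra.
Qed.

Definition slope g i : R := if descends g i then -1 else 1.

Definition height (p : A * coords) : R :=
  (len p.1)%:R + \sum_i slope p.1 i * p.2 i.

(** The last hypothesis describes the orthant opening upwards from the lowest vertex: a descending
    edge at [g] has its lower end at coordinate 1. *)
Lemma height_flat s g Y : simplex adj s -> on s Y ->
  (forall i, if descends g i then Y i <= 1 else 0 <= Y i) ->
  height (flat g Y) = (len g)%:R + \sum_i slope g i * Y i.
Proof.
move=> ss sY up; rewrite /height /len /= !natr_sum -!big_split /=.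
apply: eq_bigr => i _; set k := fun j : 'I_n => _; rewrite !ffunE.
have sk j : j \notin s -> k j = 0 by rewrite /k => /sY ->; rewrite floor0.
rewrite (st_mon_diag adj_sym adj_irr ss)//.
have [si|si] := boolP (i \in s); last first.
  by rewrite sk//= sY// floor0 mulg1 subrr !mulr0.
rewrite /slope (descends_mon adj_sym adj_irr ss)//.
have kY : k i = flr (Y i) by []; move: (floor_itv (Y i)) (up i).
rewrite -kY intrD; case: ifPn => gi Yi upi; last first.
  have k0 : 0 <= k i by rewrite kY floor_ge0.
  have [/negbTE -> sz] := st_line_up adj_sym adj_irr gi k0.
  by rewrite pmulrn sz intrD -pmulrn; lra.
(* At coordinate 1 the floor already gives the lower end of the edge: the length drops by one and
   the fractional part is 0. *)
have [Y1|Y1] := eqVneq (Y i) 1.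
  have k1 : k i = 1 by rewrite kY Y1 floor1.
  rewrite k1 Y1 /= expg1 (size_st_gen adj_sym adj_irr gi) subrr mulr0.
  by rewrite -addn1 natrD; lra.
have k0 : k i <= 0 by rewrite kY floor_le0 lt_neqAle Y1.
have [-> sz] := st_line_down adj_sym adj_irr gi k0.
by rewrite pmulrn sz intrD -pmulrn; lra.
Qed.

(** Parallel edges of a cube point the same way. *)
Lemma descends_cube s g y i : simplex adj s -> cube_coord s y -> 0 < y i < 1 ->
  descends (g * mon adj (fun i => flr (y i)))%g i = descends g i.
Proof.
move=> ss [y01 sy] yi; have si : i \in s.
  by apply: contraTT yi => /sy ->; rewrite ltxx.
rewrite (descends_mon adj_sym adj_irr ss)// => [|j /sy ->]; last first.
  by rewrite floor0.
rewrite floor01//; case: eqP => [y1|_] /=; last by rewrite mulg1.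
by rewrite y1 ltxx andbF in yi.
Qed.

Lemma height_cube s g y : simplex adj s -> cube_coord s y ->
  height (flat g y) = (len g)%:R + \sum_i slope g i * y i.
Proof.
move=> ss [y01 sy]; apply: height_flat ss sy _ => i.
by have /andP[y0 y1] := y01 i; case: ifP.
Qed.

Lemma abs_slopeM g i a : `|slope g i * a| = `|a|.
Proof. by rewrite /slope; case: ifP => _; rewrite ?mul1r // mulN1r normrN. Qed.

Lemma height_same_cube x x' l : same_cube_dist x x' l ->
  `|height (sval x) - height (sval x')| <= l.
Proof.
move=> [g [s [y [y' [ss [sy sy']]]]]].
rewrite !cube_pointE; [|exact: sy'.1|exact: sy.1] => -> -> ->.
rewrite !(height_cube _ ss)// opprD addrACA subrr add0r -sumrB.
apply: le_trans (ler_norm_sum _ _ _) _; apply: ler_sum => i _.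
by rewrite -mulrBr abs_slopeM.
Qed.

Lemma height_chain x x' l : chain x x' l ->
  `|height (sval x) - height (sval x')| <= l.
Proof.
elim=> {x x' l} [x|x y z l l' /height_same_cube xy _ yz].
  by rewrite subrr normr0.
by apply: le_trans (ler_distD (height (sval y)) _ _) _; exact: lerD.
Qed.

(** * Chains realising l^1 distances *)

Lemma chain_trans (x y z : X) l l' :
  chain x y l -> chain y z l' -> chain x z (l + l').
Proof.
elim=> {x y l} [x|x y w l l1 xy _ IH] xz; first by rewrite add0r.
by rewrite -addrA; apply: chain_cons xy _; exact: IH.
Qed.

Lemma same_cube_sym (x y : X) l : same_cube_dist x y l -> same_cube_dist y x l.
Proof.
move=> [g [s [a [b [ss [sa sb] xa yb ->]]]]]; exists g, s, b, a; split => //.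
by apply: eq_bigr => i _; rewrite distrC.
Qed.

Lemma same_cube_chain (x y : X) l : same_cube_dist x y l -> chain x y l.
Proof. by move=> xy; rewrite -[l]addr0; apply: chain_cons xy (chain_nil _). Qed.

Lemma chain_sym (x y : X) l : chain x y l -> chain y x l.
Proof.
elim=> {x y l} [x|x y z l l' xy _ zy]; first exact: chain_nil.
by rewrite addrC; apply: chain_trans zy _; exact/same_cube_chain/same_cube_sym.
Qed.

Lemma flat_same_cube s g Y Z : simplex adj s -> on s Y -> on s Z ->
  (forall i, (flr (Y i))%:~R <= Z i <= (flr (Y i))%:~R + 1) ->
  same_cube_dist (flat_point g Y) (flat_point g Z) (\sum_i `|Y i - Z i|).
Proof.
move=> ss sY sZ YZ; pose k i := flr (Y i).
have sk i : i \notin s -> k i = 0 by rewrite /k => /sY ->; rewrite floor0.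
pose rel_coord (W : coords) : coords := [ffun i => W i - (k i)%:~R].
have rel_flat W : on s W -> flat (g * mon adj k)%g (rel_coord W) = flat g W.
  move=> sW; rewrite (flat_shift _ ss)//.
    by congr flat; apply/ffunP => i; rewrite !ffunE; lra.
  by move=> i si; rewrite ffunE sW// sk// subrr.
have cubeW W : on s W -> (forall i, (k i)%:~R <= W i <= (k i)%:~R + 1) ->
    cube_coord s (rel_coord W).
  move=> sW W01; split=> i; rewrite ffunE; first by have := W01 i; lra.
  by move=> si; rewrite sW// sk// subrr.
have cY : cube_coord s (rel_coord Y).
  apply: cubeW => // i; have := floor_itv (Y i); rewrite intrD -/(k i).
  by move=> /andP[-> /ltW].
have cZ : cube_coord s (rel_coord Z) by exact: cubeW.
exists (g * mon adj k)%g, s, (rel_coord Y), (rel_coord Z); split => //.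
- by rewrite cube_pointE ?rel_flat ?(flat_pointK _ ss)//; exact: cY.1.
- by rewrite cube_pointE ?rel_flat ?(flat_pointK _ ss)//; exact: cZ.1.
- by apply: eq_bigr => i _; rewrite !ffunE opprB addrA subrK.
Qed.

Definition upd Y i a : coords := [ffun j => if j == i then a else Y j].

Lemma sum_upd Y i a b : \sum_j `|upd Y i a j - upd Y i b j| = `|a - b|.
Proof.
rewrite (bigD1 i)//= !ffunE eqxx big1 ?addr0// => j /negbTE ji.
by rewrite !ffunE ji subrr normr0.
Qed.

Lemma chain_line s g Y i a b : simplex adj s -> on s Y -> i \in s -> a <= b ->
  chain (flat_point g (upd Y i a)) (flat_point g (upd Y i b)) (b - a).
Proof.
move=> ss sY si ab; have sU c : on s (upd Y i c).
  by move=> j sj; rewrite ffunE sY//; case: eqP sj => // ->; rewrite si.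
have step c d : c <= d -> d <= (flr c)%:~R + 1 ->
    chain (flat_point g (upd Y i c)) (flat_point g (upd Y i d)) (d - c).
  move=> cd dc; rewrite -[d - c]ger0_norm ?subr_ge0// distrC -(sum_upd Y i).
  apply/same_cube_chain/(flat_same_cube _ ss) => // j; rewrite !ffunE.
  case: eqP => _; first by rewrite dc (le_trans (floor_le c)).
  by have := floor_itv (Y j); rewrite intrD => /andP[-> /ltW].
have [m bm] : exists m : nat, b <= (flr a)%:~R + m%:R.
  (* One unit for the fractional part of [a] and one for that of [b - a]. *)
  exists `|flr (b - a)|.+2; have := floor_itv (b - a); have := floor_itv a.
  rewrite !intrD -addn2 natrD natr_absz ger0_norm ?floor_ge0 ?subr_ge0//.
  lra.
elim: m a ab bm => [|m IHm] a ab bm.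
  apply: step => //; lra.
have [ba|ba] := leP b ((flr a)%:~R + 1); first exact: step.
set c := (flr a)%:~R + 1 in ba.
have ac : a <= c by have := floor_itv a; rewrite intrD -/c => /andP[_ /ltW].
rewrite (_ : b - a = (c - a) + (b - c)); last by rewrite [RHS]addrC subrKA.
apply: chain_trans (step _ _ ac _) (IHm c (ltW ba) _) => //.
have -> : flr c = flr a + 1 by rewrite /c -intrD1 intrKfloor.
by move: bm; rewrite intrD -natr1; lra.
Qed.

Lemma chain_flat s g Y Z : simplex adj s -> on s Y -> on s Z ->
  chain (flat_point g Y) (flat_point g Z) (\sum_i `|Y i - Z i|).
Proof.
(* Coordinates are corrected one at a time; [r] lists those that may still differ. *)
move=> ss sY sZ; suff main r : (forall i, i \notin r -> Y i = Z i) -> uniq r ->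
    chain (flat_point g Y) (flat_point g Z) (\sum_(i <- r) `|Y i - Z i|).
  apply: (main (index_enum _)); last exact: index_enum_uniq.
  by move=> i; rewrite mem_index_enum.
elim: r Y sY => [|i r IHr] Y sY YZ.
  move=> _; rewrite big_nil (_ : Y = Z); first exact: chain_nil.
  by apply/ffunP => i; exact: YZ.
move=> /= /andP[ir ur]; rewrite big_cons.
have Yid : Y = upd Y i (Y i).
  by apply/ffunP => j; rewrite ffunE; case: eqP => [->|].
have sU : on s (upd Y i (Z i)).
  by move=> j sj; rewrite ffunE; case: eqP sj => [->|_] /[dup] /sZ ? /sY.
apply: (@chain_trans _ (flat_point g (upd Y i (Z i)))).
  have [si|si] := boolP (i \in s); last first.
    rewrite sY// sZ// subrr normr0 (_ : upd _ _ _ = Y); first exact: chain_nil.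
    by rewrite [RHS]Yid sY.
  rewrite [X in flat_point g X]Yid; have [YZi|/ltW YZi] := leP (Y i) (Z i).
    by rewrite distrC ger0_norm ?subr_ge0//; exact: (chain_line _ ss).
  by rewrite ger0_norm ?subr_ge0//; apply/chain_sym; exact: (chain_line _ ss).
have -> : \sum_(j <- r) `|Y j - Z j| = \sum_(j <- r) `|upd Y i (Z i) j - Z j|.
  apply: eq_big_seq => j jr; rewrite ffunE; case: eqP => // ji.
  by rewrite -ji jr in ir.
apply: IHr => // j; rewrite ffunE => jr; case: eqP => [->//|/eqP ji].
by apply: YZ; rewrite inE (negbTE ji).
Qed.

Lemma edge_dist g i :
  same_cube_dist (vertex R adj g) (vertex R adj (g * gen adj i)%g) 1.
Proof.
exists g, [set i]%SET, [ffun=> 0], [ffun j => (j == i)%:R]; split.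
- by apply/simplexP => j k /finset.set1P-> /finset.set1P->; rewrite eqxx.
- split; split=> j; rewrite !ffunE ?lexx ?ler01//.
    by rewrite ler0n lern1 leq_b1.
  by rewrite finset.inE => /negbTE->.
- rewrite /cube_point /= big1; last by move=> j; rewrite ffunE eq_sym oner_eq0.
  rewrite mulg1; congr pair; apply/ffunP => j.
  by rewrite !ffunE eq_sym oner_eq0.
- rewrite /cube_point /= (big_pred1 i); last first.
    by move=> j; rewrite ffunE pnatr_eq1 eqb1.
  congr pair; apply/ffunP => j; rewrite !ffunE pnatr_eq1.
  by case: (j == i).
- rewrite (bigD1 i)//= !ffunE eqxx big1 => [|j /negbTE ji].
    by rewrite addr0 sub0r normrN1.
  by rewrite !ffunE ji subrr normr0.
Qed.

Lemma chain_vertex g : chain (basepoint R adj) (vertex R adj g) (len g)%:R.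
Proof.
have [w [rw clw _]] := reduceP adj_sym adj_irr (repr g).
rewrite -(class_of_repr g) -clw (len_reduced adj_sym adj_irr rw).
elim: rw => {w clw} [|w l _ IHw _]; first exact: chain_nil.
rewrite size_rcons -natr1; apply: chain_trans IHw (same_cube_chain _).
rewrite class_of_rcons; case: l => i [|]; first exact: edge_dist.
rewrite -[(i, false)]/(flip (i, true)) lett_flip; apply: same_cube_sym.
set h := class_of adj w.
by rewrite -[X in same_cube_dist _ (vertex R adj X)](mulgVK (gen adj i) h);
  exact: edge_dist.
Qed.

Lemma flat_id g y : (forall i, 0 <= y i < 1) -> flat g y = (g, y).
Proof.
move=> y01; have y0 i : flr (y i) = 0 by apply: floor_def; rewrite add0r y01.
rewrite /flat /mon big1 => [|i _]; last by rewrite y0.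
by rewrite mulg1; congr pair; apply/ffunP => i; rewrite ffunE y0 subr0.
Qed.

Lemma univ_coverP x : exists s, [/\ simplex adj s, cube_coord s (sval x).2,
  forall i, (sval x).2 i < 1 & x = flat_point (sval x).1 (sval x).2].
Proof.
case: x => -[g y] /= xS; have /andP[/= /forallP y01 ss] := xS.
exists [set i | y i != 0]%SET; split=> //.
- split=> i; first by have /andP[-> /ltW] := y01 i.
  by rewrite inE negbK => /eqP.
- by move=> i; case/andP: (y01 i).
apply/val_inj; rewrite /= (flat_pointK _ ss); first by rewrite flat_id.
by move=> i; rewrite inE negbK => /eqP.
Qed.

Lemma flat_point_vertex s g (b : pred 'I_n) : simplex adj s ->
  (forall i, i \notin s -> b i = false) ->
  flat_point g [ffun i => (b i)%:R] =
  vertex R adj (g * mon adj (fun i => Posz (b i)))%g.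
Proof.
move=> ss sb; apply/val_inj; rewrite /= (flat_pointK _ ss); last first.
  by move=> i /sb bi; rewrite ffunE bi.
have bK i : flr ((b i)%:R : R) = Posz (b i) := intrKfloor (Posz (b i)).
rewrite /flat; congr (_ * _, _)%g.
  by apply: eq_bigr => i _; rewrite ffunE bK.
by apply/ffunP => i; rewrite !ffunE bK subrr.
Qed.

Lemma height_vertex g : height (sval (vertex R adj g)) = (len g)%:R.
Proof. by rewrite /height big1 ?addr0// => i _; rewrite ffunE mulr0. Qed.

Lemma chain_base x : chain (basepoint R adj) x (height (sval x)).
Proof.
have [s [ss /[dup] cy [y01 sy] y1 xE]] := univ_coverP x; move: cy y01 sy y1 xE.
case: (sval x) => g y /= cy y01 sy y1 ->.
(* [c] is the lowest vertex of the cube; the path goes there first and then rises inside the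
   cube. *)
pose b i := (i \in s) && descends g i; pose c : coords := [ffun i => (b i)%:R].
have sb i : i \notin s -> b i = false by rewrite /b => /negbTE->.
have sc : on s c by move=> i /sb bi; rewrite ffunE bi.
have cc : cube_coord s c.
  by split=> // i; rewrite ffunE ler0n lern1 leq_b1.
have bc := chain_vertex (g * mon adj (fun i => Posz (b i)))%g.
have := height_vertex (g * mon adj (fun i => Posz (b i)))%g.
rewrite -(flat_point_vertex _ ss)// (flat_pointK _ ss)//.
rewrite (height_cube _ ss)// => bE.
have -> : height (g, y) = (len (g * mon adj (fun i => Posz (b i)))%g)%:R +
    \sum_i `|c i - y i|.
  rewrite -bE -addrA -big_split /=; congr (_ + _); apply: eq_bigr => i _.
  rewrite ffunE /slope /b; have /andP[y0 y1i] := y01 i.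
  have [si|/sy ->] := boolP (i \in s); last first.
    by rewrite subrr normr0 !mulr0 addr0.
  case: ifP => _ /=; last by rewrite mulr0 sub0r normrN ger0_norm// mul1r add0r.
  by rewrite ger0_norm ?subr_ge0//; lra.
apply: chain_trans bc _; rewrite -(flat_point_vertex _ ss)//.
exact: (chain_flat _ ss).
Qed.

Lemma dist1_le_chain x x' l : chain x x' l -> (dist1 x x' <= l%:E)%E.
Proof. by move=> xx'; apply: ereal_inf_lbound; exists l. Qed.

Lemma dist1_base x : dist1 (basepoint R adj) x = (height (sval x))%:E.
Proof.
have len1 : len (1%g : A) = 0.
  exact: len_reduced adj_sym adj_irr _ (reduced_nil adj).
apply/eqP; rewrite eq_le dist1_le_chain/=; last exact: chain_base.
apply: le_ereal_inf_tmp => _ [l /height_chain bx <-]; rewrite lee_fin.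
by apply: le_trans bx; rewrite distrC height_vertex len1 subr0 ler_norm.
Qed.

Lemma height_ge0 x : 0 <= height (sval x).
Proof. exact: le_trans (height_chain (chain_base x)). Qed.

End Flats.

(** * The pushing map *)

Section Push.
Variables (R : realType) (n : nat) (adj : rel 'I_n).
Hypotheses (adj_sym : symmetric adj) (adj_irr : irreflexive adj).
Local Notation A := (raag adj).
Local Notation X := (univ_cover R adj).
Local Notation coords := {ffun 'I_n -> R}.
Implicit Types (g : A) (y z : coords) (x : X) (s : {set 'I_n}).

Definition phi (a : R) : R := Num.min a (1 - a).

(* The l^1 distance from y in [0, 1]^n to {0, 1}^n. *)
Definition vdist y : R := \sum_i phi (y i).

Section Speed.
Variables (M : R) (M1 : 1 <= M).

Let M0 : 0 < M := lt_le_trans ltr01 M1.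

(* Equal to u / d when u <= M * d; the truncation makes it meaningful, and    *)
(* the pushing map Lipschitz, at the vertices of X as well.                   *)
Definition speed (u d : R) : R := u / Num.max d (u / M).

Lemma speed_bounds u d : 0 <= u -> 0 <= d ->
  [/\ 0 <= speed u d, speed u d <= M & speed u d * Num.max d (u / M) = u].
Proof.
move=> u0 d0; rewrite /speed; set e := Num.max _ _.
have de : d <= e by rewrite le_max lexx.
have ue : u / M <= e by rewrite le_max lexx orbT.
(* Here [u] vanishes, and division by zero gives speed 0. *)
have [e0|e0] := eqVneq e 0.
  have -> : u = 0.
    apply/eqP; rewrite eq_le u0 andbT.
    by move: ue; rewrite e0 ler_pdivrMr// mul0r.
  by rewrite !mul0r lexx (ltW M0).
have e_gt0 : 0 < e by rewrite lt_neqAle eq_sym e0 (le_trans d0).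
rewrite divr_ge0 ?(ltW e_gt0)// divfK// ler_pdivrMr// mulrC.
by rewrite -ler_pdivrMr.
Qed.

(** Speeds are not uniformly Lipschitz near [u = d = 0], but become so with the weight [d']. With
    [t e = u] and [t' e' = u'] for the truncated denominators,
    [(t - t') e' = t (e' - e) + (u - u')]. *)
Lemma speed_lipschitz u u' d d' c : 0 <= u -> 0 <= u' -> 0 <= d -> 0 <= d' ->
  `|u - u'| <= c -> `|d - d'| <= c ->
  `|speed u d - speed u' d'| * d' <= (M + 1) * c.
Proof.
move=> u0 u'0 d0 d'0 uc dc.
have [t0 tM tE] := speed_bounds u0 d0; have [t'0 _ tE'] := speed_bounds u'0 d'0.
set t := speed u d in t0 tM tE *; set t' := speed u' d' in t'0 tE' *.
set e := Num.max _ _ in tE; set e' := Num.max _ _ in tE'.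
have ee' : `|e' - e| <= c.
  have : `|u / M - u' / M| <= c.
    rewrite -mulrBl normrM normfV (gtr0_norm M0) ler_pdivrMr//.
    by rewrite (le_trans uc)// ler_peMr// (le_trans _ uc).
  rewrite /e /e'; move: (u / M) (u' / M) dc => a a'; rewrite !ler_norml.
  move=> /andP[? ?] /andP[? ?].
  by case: (leP d a) => ?; case: (leP d' a') => ?; apply/andP; split; lra.
have d'e' : d' <= e' by rewrite le_max lexx.
apply: le_trans (_ : `|t - t'| * e' <= _); first exact: ler_wpM2l.
rewrite -[e' in leLHS]ger0_norm ?(le_trans d'0)// -normrM.
rewrite (_ : _ * e' = t * (e' - e) + (u - u')); last by rewrite -tE -tE'; ring.
apply: le_trans (ler_normD _ _) _; rewrite mulrDl mul1r lerD//.
by rewrite normrM (ger0_norm t0) ler_pM.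
Qed.

Definition push_coord g u y : coords :=
  [ffun i => y i + slope R g i * (speed u (vdist y) * phi (y i))].

Lemma push_coordE g u y i :
  push_coord g u y i = y i + slope R g i * (speed u (vdist y) * phi (y i)).
Proof. by rewrite ffunE. Qed.

Lemma phi_ge0 a : 0 <= a <= 1 -> 0 <= phi a.
Proof. by move=> /andP[? ?]; rewrite /phi; case: (leP a (1 - a)); lra. Qed.

Lemma phi_lipschitz a b : `|phi a - phi b| <= `|a - b|.
Proof.
rewrite /phi; case: (leP a (1 - a)) => ?; case: (leP b (1 - b)) => ?;
  by rewrite ler_norml; case: (ger0P (a - b)) => ?; apply/andP; split; lra.
Qed.

Lemma vdist_ge0 y : (forall i, 0 <= y i <= 1) -> 0 <= vdist y.
Proof. by move=> y01; apply: sumr_ge0 => i _; exact: phi_ge0. Qed.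

Lemma vdist_lipschitz y z : `|vdist y - vdist z| <= \sum_i `|y i - z i|.
Proof.
rewrite /vdist -sumrB; apply: le_trans (ler_norm_sum _ _ _) _.
by apply: ler_sum => i _; exact: phi_lipschitz.
Qed.

(** The displacement of coordinates costs [1 + M]. The change of speed costs [M + 1], since its
    weights [phi (z i)] add up to [vdist z]. *)
Lemma push_coord_lipschitz g u u' y z :
  (forall i, 0 <= y i <= 1) -> (forall i, 0 <= z i <= 1) -> 0 <= u -> 0 <= u' ->
  `|u - u'| <= \sum_i `|y i - z i| ->
  \sum_i `|push_coord g u y i - push_coord g u' z i| <=
    (2 * M + 2) * \sum_i `|y i - z i|.
Proof.
move=> y01 z01 u0 u'0; set c := \sum_i _ => uc.
have [t0 tM _] := speed_bounds u0 (vdist_ge0 y01).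
have dc := vdist_lipschitz y z.
have := speed_lipschitz u0 u'0 (vdist_ge0 y01) (vdist_ge0 z01) uc dc.
set t := speed _ _ in t0 tM *; set t' := speed u' _ => tt'.
apply: (@le_trans _ _
    (\sum_i ((1 + M) * `|y i - z i| + `|t - t'| * phi (z i)))).
  apply: ler_sum => i _; rewrite !ffunE -/t -/t'.
  rewrite (_ : _ - _ = (y i - z i) + slope R g i *
    (t * (phi (y i) - phi (z i)) + (t - t') * phi (z i))); last by ring.
  apply: le_trans (ler_normD _ _) _; rewrite abs_slopeM.
  rewrite [(1 + M) * _]mulrDl mul1r -addrA lerD2l.
  apply: le_trans (ler_normD _ _) _.
  rewrite (normrM t) (normrM (t - t')) (ger0_norm t0) lerD//.
    by rewrite ler_pM// phi_lipschitz.
  by rewrite (ger0_norm (phi_ge0 _)).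
rewrite big_split /= -!mulr_sumr -/(vdist z) -/c.
by apply: le_trans (lerD (lexx _) tt') _; lra.
Qed.

Lemma push_coord_on s g u y : on s y -> on s (push_coord g u y).
Proof.
by move=> sy i /sy yi; rewrite ffunE yi /phi min_l ?subr0 ?ler01// !mulr0 addr0.
Qed.

Lemma push_coord_id g y : push_coord g 0 y = y.
Proof. by apply/ffunP => i; rewrite ffunE /speed !mul0r mulr0 addr0. Qed.

Lemma push_coord_up g u y i : 0 <= u -> (forall i, 0 <= y i <= 1) ->
  if descends g i then push_coord g u y i <= 1 else 0 <= push_coord g u y i.
Proof.
move=> u0 y01; rewrite ffunE /slope.
have [t0 _ _] := speed_bounds u0 (vdist_ge0 y01).
have := mulr_ge0 t0 (phi_ge0 (y01 i)); have := y01 i.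
by case: (descends g i); lra.
Qed.

Section PushMap.
Variable r : R.

Definition gap x : R := Num.max 0 (r - height (sval x)).

Definition push_map x : X :=
  flat_point (sval x).1 (push_coord (sval x).1 (gap x) (sval x).2).

Lemma gap_ge0 x : 0 <= gap x.
Proof. by rewrite le_max lexx. Qed.

(** Changing the chart turns coordinates 1 into 0, and [phi] vanishes at both. A coordinate that
    moves is interior to its edge, whose direction is the same in both charts. *)
Lemma push_map_flat s g y x : simplex adj s -> cube_coord s y ->
  sval x = flat g y -> push_map x = flat_point g (push_coord g (gap x) y).
Proof.
move=> ss /[dup] cy [y01 sy] xE; rewrite /push_map; move: (gap x) => u.
pose k i := Num.floor (y i); pose y' : coords := [ffun i => y i - (k i)%:~R].
rewrite xE /flat_point; congr insubd.
rewrite -[LHS]/(flat (g * mon adj k)%g (push_coord (g * mon adj k)%g u y')).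
have phiE i : phi (y' i) = phi (y i).
  rewrite ffunE /k floor01//; case: eqP => [->|_]; last by rewrite subr0.
  by rewrite /phi /= !subrr subr0 minC.
have sk i : i \notin s -> k i = 0 by rewrite /k => /sy ->; rewrite floor0.
have sy' : on s y' by move=> i si; rewrite ffunE sy// sk// subrr.
rewrite (flat_shift _ ss)//; last exact: push_coord_on.
congr flat; apply/ffunP => i; rewrite ffunE !push_coordE phiE.
have -> : vdist y' = vdist y by apply: eq_bigr => j _; exact: phiE.
have -> : y' i = y i - (k i)%:~R by rewrite ffunE.
rewrite addrA [X in X + _]addrCA subrr addr0; congr (_ + _).
have [yi|] := boolP (0 < y i < 1).
  by rewrite /slope (descends_cube adj_sym adj_irr g ss cy yi).
move=> yi; have -> : phi (y i) = 0.
  move: (y01 i) yi; rewrite /phi negb_and -!leNgt => /andP[? ?].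
  by case: (leP (y i) (1 - y i)) => ? /orP[] ?; lra.
by rewrite !mulr0.
Qed.

Lemma gap_lipschitz x x' l : `|height (sval x) - height (sval x')| <= l ->
  `|gap x - gap x'| <= l.
Proof.
rewrite /gap !ler_norml => /andP[? ?].
case: (leP 0 (r - height (sval x))) => ?;
  by case: (leP 0 (r - height (sval x'))) => ?; apply/andP; split; lra.
Qed.

Lemma push_map_chain x x' l : chain x x' l ->
  exists2 l', chain (push_map x) (push_map x') l' & l' <= (2 * M + 2) * l.
Proof.
elim=> {x x' l} [x|x x' z l l0 xx' _ [l1 c1 l1_le]].
  by exists 0; [exact: chain_nil|rewrite mulr0].
have hl := height_same_cube adj_sym adj_irr xx'.
case: xx' => g [s [y [y' [ss [cy cy']]]]].
rewrite !cube_pointE; [|exact: cy'.1|exact: cy.1] => xE x'E lE.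
have := chain_flat g ss (push_coord_on g (gap x) cy.2)
  (push_coord_on g (gap x') cy'.2).
rewrite -(push_map_flat ss cy xE) -(push_map_flat ss cy' x'E) => c0.
exists (\sum_i `|push_coord g (gap x) y i - push_coord g (gap x') y' i| + l1).
  exact: chain_trans c0 c1.
rewrite mulrDr lerD// lE; apply: push_coord_lipschitz; rewrite ?gap_ge0//.
- exact: cy.1.
- exact: cy'.1.
- by rewrite -lE; exact: gap_lipschitz.
Qed.

Lemma push_map_dist x x' :
  (dist1 (push_map x) (push_map x') <= (2 * M + 2)%:E * dist1 x x')%E.
Proof.
have K0 : 0 < 2 * M + 2 by move: M0; lra.
rewrite muleC -lee_pdivrMr// ?lte_fin//; apply: le_ereal_inf_tmp.
move=> _ [l /push_map_chain[l' c' l'l] <-].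
rewrite lee_pdivrMr// -EFinM; apply: le_trans (dist1_le_chain c') _.
by rewrite lee_fin mulrC.
Qed.

Lemma push_map_id x : r <= height (sval x) -> push_map x = x.
Proof.
move=> rx; have [s [_ _ _ xE]] := univ_coverP x.
by rewrite [RHS]xE /push_map /gap max_l ?push_coord_id// subr_le0.
Qed.

(** Each coordinate moves along its slope and slopes square to 1, so the height grows by speed times
    [vdist]; the hypothesis says that the speed is not truncated. *)
Lemma height_push_map x :
  gap x <= M * vdist (sval x).2 -> r <= height (sval (push_map x)).
Proof.
move=> ux; have [s [ss [y01 sy] y1 _]] := univ_coverP x; rewrite /push_map.
have u0 := gap_ge0 x; have d0 := vdist_ge0 y01.
rewrite (flat_pointK _ ss); last exact: push_coord_on.
rewrite (height_flat adj_sym adj_irr ss); last 2 first.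
- exact: push_coord_on.
- by move=> i; exact: push_coord_up.
have -> : \sum_i slope R (sval x).1 i *
      push_coord (sval x).1 (gap x) (sval x).2 i =
    \sum_i slope R (sval x).1 i * (sval x).2 i
    + speed (gap x) (vdist (sval x).2) * vdist (sval x).2.
  rewrite /vdist mulr_sumr -big_split /=; apply: eq_bigr => i _.
  rewrite ffunE mulrDr mulrA; congr (_ + _).
  by rewrite /slope; case: ifP => _; rewrite ?mulrNN !mul1r.
rewrite addrA -/(height _); have [_ _] := speed_bounds u0 d0.
rewrite max_l => [->|]; last by rewrite ler_pdivrMr// mulrC.
have : r - height (sval x) <= gap x by rewrite /gap le_max lexx orbT.
by rewrite /height; lra.
Qed.

End PushMap.
End Speed.

(** * The punctured space *)

Lemma near_vertex x : exists g, chain (vertex R adj g) x (vdist (sval x).2).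
Proof.
have [s [ss [y01 sy] y1 xE]] := univ_coverP x.
pose b i := 1 / 2 <= (sval x).2 i.
have sb i : i \notin s -> b i = false.
  by move=> /sy; rewrite /b => ->; apply/negbTE; rewrite -ltNge; lra.
exists ((sval x).1 * mon adj (fun i => Posz (b i)))%g.
rewrite -(flat_point_vertex R _ ss)// [X in chain _ X]xE.
have -> : vdist (sval x).2 =
    \sum_i `|([ffun i => (b i)%:R] : coords) i - (sval x).2 i|.
  apply: eq_bigr => i _; rewrite ffunE /b /phi; have := y01 i.
  case: (leP (1 / 2)) => /= ? ?.
    by rewrite ger0_norm; [case: (leP _ (1 - (sval x).2 i)) => ?|]; lra.
  rewrite sub0r normrN ger0_norm; last lra.
  by case: (leP _ (1 - (sval x).2 i)) => ?; lra.
apply: (chain_flat _ ss) => // i si; by rewrite ffunE sb.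
Qed.

Lemma punctured_gap r x : 0 < r -> punctured adj r x ->
  gap r x <= (1 + 4 * r) * vdist (sval x).2.
Proof.
move=> r0 px; have [g gx] := near_vertex x.
have [s [_ [y01 _] _ _]] := univ_coverP x; have d0 := vdist_ge0 y01.
have hx := height_ge0 adj_sym adj_irr x.
(* Far from the vertices, [(1 + 4 * r) / 4] exceeds [r]. Otherwise the nearest vertex lies outside
   B_r, so the gap is at most the distance to it. *)
have [d4|d4] := leP (1 / 4) (vdist (sval x).2).
  by rewrite /gap; case: (leP 0 (r - height (sval x))) => ?; nra.
have rg : r <= height (sval (vertex R adj g)).
  rewrite leNgt; apply/negP => gr; apply: px; exists (vertex R adj g).
    by split; [exists g|rewrite /Bbase /oball /= dist1_base// lte_fin].
  by apply: le_lt_trans (dist1_le_chain gx) _; rewrite lte_fin.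
have := height_chain adj_sym adj_irr gx; rewrite ler_norml /gap => ?.
by case: (leP 0 (r - height (sval x))) => ?; nra.
Qed.

End Push.

(** The trivial partition already bounds the length of a path by the distance of its ends. *)
Lemma length_dist_ge (R : realType) (T : Type) (d : T -> T -> \bar R)
    (D : set T) x y : (d x y <= length_dist d D x y)%E.
Proof.
apply: le_ereal_inf_tmp => _ [gam [g0 g1 _ _] <-]; apply: ereal_sup_ubound.
exists [:: 1]; first exact: itv_partition1.
by rewrite big_ord1 /= g0 g1.
Qed.

Theorem theorem4p1 (R : realType) (n : nat) (adj : rel 'I_n)
    (adj_sym : symmetric adj) (adj_irr : irreflexive adj) :
  exists2 c : R, 0 < c &
    forall r : R, 0 < r ->
      exists P : univ_cover R adj -> univ_cover R adj,
        retraction (punctured adj r) (~` Bbase adj r) P /\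
        lipschitz_between (punctured adj r)
          (length_dist dist1 (punctured adj r)) dist1 (c * r + c) P.
Proof.
(* The stretch [2 * M + 2] equals [8 * r + 4]. *)
exists 8 => // r r0; have M1 : 1 <= 1 + 4 * r by lra.
exists (push_map (1 + 4 * r) r); split; [split=> [x px|x [_ rx]]|].
- rewrite /Bbase /oball /= dist1_base// lte_fin; apply/negP; rewrite -leNgt.
  exact/height_push_map/punctured_gap.
- apply: push_map_id; rewrite leNgt; apply/negP => xr; apply: rx.
  by rewrite /Bbase /oball /= dist1_base// lte_fin.
- move=> x y _ _; apply: le_trans (push_map_dist adj_sym adj_irr M1 r x y) _.
  have K : 2 * (1 + 4 * r) + 2 <= 8 * r + 8 by lra.
  apply: lee_pmul; rewrite ?lee_fin ?length_dist_ge//; first lra.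
  (* Nonnegativity of [dist1]: the length of a chain bounds a difference of heights. *)
  apply: le_ereal_inf_tmp => _ [l /(height_chain adj_sym adj_irr) xy <-].
  by rewrite lee_fin (le_trans _ xy).
Qed.
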